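(* Let $\mathsf{K}$ be a finitely generated variety of Heyting algebras, or a finitely generated variety of Brouwerian algebras. Then every $\mathsf{K}$-epimorphism is surjective.
   Context: A Brouwerian algebra is an algebra $\langle A;\to,\wedge,\vee,\top\rangle$ such that $\langle A;\wedge,\vee\rangle$ is a lattice with greatest element $\top$ and $x\wedge y\leqslant z\iff x\leqslant y\to z$. A Heyting algebra is a Brouwerian algebra expanded by a distinguished least element $\bot$. A variety is finitely generated if it is the variety generated by some finite algebra. A class $\mathsf{K}$ of similar algebras is regarded as a category whose morphisms are all algebraic homomorphisms between members of $\mathsf{K}$. A $\mathsf{K}$-morphism $h\colon A\to B$ is a $\mathsf{K}$-epimorphism if, for all $\mathsf{K}$-morphisms $f,g$ from $B$ to a single member of $\mathsf{K}$, $f\circ h=g\circ h$ implies $f=g$. *)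

(* Defs.v *)
From mathcomp Require Import all_boot.
From mathcomp Require Import boolp classical_sets functions cardinality.

Set Implicit Arguments.
Unset Strict Implicit.
Unset Printing Implicit Defensive.

Record signature := Signature { op : Type; arity : op -> nat }.

Record algebra (S : signature) := Algebra {
  carrier :> Type;
  interp : forall o : op S, (arity o).-tuple carrier -> carrier }.

Definition homomorphism (S : signature) (A B : algebra S) (h : A -> B) : Prop :=
  forall (o : op S) (t : (arity o).-tuple A),
    h (interp t) = interp (map_tuple h t).

(* The arguments form a function on 'I_(arity o), not a tuple, because a tuple
   of terms would not be a strictly positive occurrence. *)
Inductive term (S : signature) : Type :=
| Var of nat
| App (o : op S) of 'I_(arity o) -> term S.

Fixpoint eval (S : signature) (A : algebra S) (v : nat -> A) (t : term S) : A :=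
  match t with
  | Var n => v n
  | App o ts => interp [tuple eval v (ts i) | i < arity o]
  end.

Definition satisfies (S : signature) (A : algebra S) (e : term S * term S) :
    Prop :=
  forall v : nat -> A, eval v e.1 = eval v e.2.

Definition variety (S : signature) (K : algebra S -> Prop) : Prop :=
  exists E : term S * term S -> Prop,
    forall A : algebra S, K A <-> (forall e, E e -> satisfies A e).

Definition variety_generated_by (S : signature) (F : algebra S)
    (K : algebra S -> Prop) : Prop :=
  [/\ variety K, K F &
      forall K' : algebra S -> Prop,
        variety K' -> K' F -> forall A, K A -> K' A].

Definition finitely_generated_variety (S : signature)
    (K : algebra S -> Prop) : Prop :=
  exists2 F : algebra S, finite_set [set: F] & variety_generated_by F K.

Definition epimorphism (S : signature) (K : algebra S -> Prop)
    (A B : algebra S) (h : A -> B) : Prop :=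
  [/\ K A, K B, homomorphism h &
      forall (C : algebra S) (f g : B -> C),
        K C -> homomorphism f -> homomorphism g ->
        f \o h =1 g \o h -> f =1 g].

Inductive brouwerian_op := OpImp | OpMeet | OpJoin | OpTop.

Definition brouwerian_sig : signature :=
  Signature (fun o => if o is OpTop then 0 else 2).

Inductive heyting_op := OpBrouwerian of brouwerian_op | OpBot.

Definition heyting_sig : signature :=
  Signature (fun o => if o is OpBrouwerian o' then @arity brouwerian_sig o'
                      else 0).

Definition imp (A : algebra brouwerian_sig) (x y : A) : A :=
  @interp _ A OpImp [tuple x; y].
Definition meet (A : algebra brouwerian_sig) (x y : A) : A :=
  @interp _ A OpMeet [tuple x; y].
Definition join (A : algebra brouwerian_sig) (x y : A) : A :=
  @interp _ A OpJoin [tuple x; y].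
Definition top (A : algebra brouwerian_sig) : A :=
  @interp _ A OpTop [tuple].
Definition leq_alg (A : algebra brouwerian_sig) (x y : A) : Prop :=
  meet x y = x.

Definition is_lattice (T : Type) (m j : T -> T -> T) : Prop :=
  [/\ commutative m, associative m, commutative j, associative j &
      (forall x y, m x (j x y) = x) /\ (forall x y, j x (m x y) = x)].

Definition brouwerian (A : algebra brouwerian_sig) : Prop :=
  [/\ is_lattice (@meet A) (@join A),
      forall x : A, leq_alg x (top A) &
      forall x y z : A, leq_alg (meet x y) z <-> leq_alg x (imp y z)].

Definition brouwerian_reduct (A : algebra heyting_sig) :
    algebra brouwerian_sig :=
  @Algebra brouwerian_sig A (fun o => @interp _ A (OpBrouwerian o)).

Definition bot (A : algebra heyting_sig) : A := @interp _ A OpBot [tuple].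

Definition heyting (A : algebra heyting_sig) : Prop :=
  brouwerian (brouwerian_reduct A) /\
  forall x : brouwerian_reduct A, leq_alg (bot A : brouwerian_reduct A) x.

(* Main.v *)
Require Import Defs.
From mathcomp Require Import all_boot.
From mathcomp Require Import boolp classical_sets cardinality.

(** The argument is dual: a Brouwerian algebra B is studied through the poset of
    its prime filters, where the filter B itself counts as prime, and a
    homomorphism h : A -> B through the map that sends a prime filter of B to
    its inverse image under h, called its trace.

    Let d_0 = x_0 and d_(k+1) = x_(k+1) \/ (x_(k+1) -> d_k). These values
    increase strictly until they reach the top, so a finite algebra satisfies
    the equation d_n = top for some n ([finite_depth]). The equation passes
    to the whole variety, and there it forces every nonempty family of prime
    filters to have a maximal member ([prime_maximal]).

    If some element of B is not in the image of h, then two distinct prime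
    filters have the same trace ([same_trace_primes]). Let P be maximal among
    the prime filters that share their trace with another one, and P' maximal
    among the others with the trace of P. Traces lift upwards ([prime_lift]),
    and every prime filter strictly above P is determined by its trace; so,
    apart from P and P' themselves, P and P' have the same prime filters above
    them, with the possible exception that P' lies below P
    ([separating_primes]). Therefore the map tau that sends P' to P and fixes
    every prime filter strictly above P' preserves traces and maps the primes
    above Q onto the primes above tau(Q), for every Q above P'. Dually, tau
    yields a homomorphism from B to its quotient B/P'. It agrees with the
    projection on the image of h, because tau preserves traces, and differs
    from the projection at every element of P outside P'. The quotient B/P' is
    again in the variety, so h is not an epimorphism ([separating_congruence],
    [epimorphism_congruence]).

    For Heyting algebras the construction takes place in the Brouwerian reducts.
    The second homomorphism preserves the bottom element because bottom is in
    the image of h, where the two homomorphisms agree. *)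

Set Implicit Arguments.
Unset Strict Implicit.
Unset Printing Implicit Defensive.

(** * Congruences and varieties *)

Lemma tuple2E T (t : 2.-tuple T) :
  t = [tuple tnth t ord0; tnth t (lift ord0 ord0)].
Proof.
by apply: eq_from_tnth; case=> [[|[|//]]] i; congr tnth; apply: val_inj.
Qed.

Section UniversalAlgebra.
Variable S : signature.
Implicit Types (A B C : algebra S) (K : algebra S -> Prop).

Definition congruence B (th : B -> B -> Prop) : Prop :=
  [/\ forall x, th x x,
      forall x y, th x y -> th y x,
      forall x y z, th x y -> th y z -> th x z &
      forall o (t u : (arity o).-tuple B),
        (forall i, th (tnth t i) (tnth u i)) -> th (interp t) (interp u)].

(** The composite of [s] with the projection modulo [th] is a homomorphism;
    stated without forming the quotient. *)
Definition homomorphism_mod B (th : B -> B -> Prop) (s : B -> B) : Prop :=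
  forall o (t : (arity o).-tuple B),
    th (s (interp t)) (interp (map_tuple s t)).

Lemma homomorphism_eval A B (h : A -> B) (v : nat -> A) (t : term S) :
  homomorphism h -> h (eval v t) = eval (h \o v) t.
Proof.
move=> hh; elim: t => [//|o ts IH] /=.
rewrite hh; congr (interp _); apply: eq_from_tnth => i.
by rewrite tnth_map !tnth_mktuple.
Qed.

Lemma variety_image K B C (q : B -> C) :
  variety K -> homomorphism q -> (forall c, exists b, q b = c) -> K B -> K C.
Proof.
move=> [E KE] hq /choice[r rK] /KE KB; apply/KE => e /KB Be w.
have -> : w = q \o (r \o w) by apply/funext => n /=; rewrite rK.
by rewrite -!(homomorphism_eval _ _ hq) Be.
Qed.

Section Quotient.
Variables (B : algebra S) (th : B -> B -> Prop).

(** A class is represented by the predicate [th b], so that equality of classes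
    is equality of predicates. *)
Definition quotient_carrier : Type := {X : B -> Prop | exists b, X = th b}.

Definition quotient_map (b : B) : quotient_carrier :=
  exist _ (th b) (ex_intro _ b erefl).

Definition quotient_repr (X : quotient_carrier) : B := projT1 (cid (svalP X)).

Definition quotient_algebra : algebra S :=
  @Algebra S quotient_carrier (fun o t =>
    quotient_map (interp (map_tuple quotient_repr t))).

Lemma quotient_reprK X : quotient_map (quotient_repr X) = X.
Proof.
rewrite /quotient_map /quotient_repr; case: X => X pX /=.
case: cid => b /= e; subst X.
by congr exist; apply: Prop_irrelevance.
Qed.

Hypothesis thC : congruence th.

Lemma quotient_mapP x y : quotient_map x = quotient_map y <-> th x y.
Proof.
have [rf sy tr _] := thC; split=> [[e]|xy]; first by rewrite e.
have e : th x = th y.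
  by apply/funext => z; apply/propext; split; apply: tr => //; apply: sy.
by rewrite /quotient_map; move: (ex_intro _ x _); rewrite e => p;
   congr exist; apply: Prop_irrelevance.
Qed.

Lemma quotient_map_hom :
  @homomorphism S B quotient_algebra quotient_map.
Proof.
move=> o t /=; apply/quotient_mapP.
have [_ _ _ compat] := thC; apply: compat => i.
by rewrite !tnth_map; apply/quotient_mapP; rewrite quotient_reprK.
Qed.

End Quotient.

(** The projection to the quotient and its composite with [s] are two morphisms
    of [K] that agree on the image of [h]. *)
Lemma epimorphism_congruence K A B (h : A -> B) (th : B -> B -> Prop)
    (s : B -> B) :
  variety K -> epimorphism K h ->
  congruence th -> homomorphism_mod th s -> (forall a, th (s (h a)) (h a)) ->
  forall b, th (s b) b.
Proof.
move=> Kvar [KA KB hh hepi] thC sh sA b; apply/(quotient_mapP thC).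
have qh := quotient_map_hom thC.
have KC : K (quotient_algebra th).
  apply: (variety_image Kvar qh) KB => c.
  by exists (quotient_repr c); exact: quotient_reprK.
apply: (hepi (quotient_algebra th) (quotient_map th \o s) (quotient_map th))
  => //.
- move=> o t; transitivity (quotient_map th (interp (map_tuple s t))).
    exact/(quotient_mapP thC)/sh.
  rewrite qh; congr (interp _); apply: eq_from_tnth => i.
  by rewrite !tnth_map.
- by move=> a /=; apply/(quotient_mapP thC).
Qed.

End UniversalAlgebra.

(** * Order and prime filters in Brouwerian algebras *)

Section Order.
Variables (B : algebra brouwerian_sig) (HB : brouwerian B).
Implicit Types x y z : B.
Local Notation "x <<= y" := (leq_alg x y) (at level 70).

Lemma leq_refl_alg x : x <<= x.
Proof.
have [[mC mA jC jA [mj jm]] _ _] := HB.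
by rewrite /leq_alg -{2}(jm x x) mj.
Qed.

Lemma leq_trans_alg y x z : x <<= y -> y <<= z -> x <<= z.
Proof.
have [[mC mA _ _ _] _ _] := HB.
by rewrite /leq_alg => xy yz; rewrite -xy -mA yz.
Qed.

Lemma leq_anti_alg x y : x <<= y -> y <<= x -> x = y.
Proof.
have [[mC _ _ _ _] _ _] := HB.
by rewrite /leq_alg => xy yx; rewrite -xy mC.
Qed.

Lemma meet_lel x y : meet x y <<= x.
Proof.
have [[mC mA _ _ _] _ _] := HB.
by rewrite /leq_alg mC mA [meet x x]leq_refl_alg.
Qed.

Lemma meet_ler x y : meet x y <<= y.
Proof. by have [[mC _ _ _ _] _ _] := HB; rewrite mC; apply: meet_lel. Qed.

Lemma leq_meet x y z : z <<= x -> z <<= y -> z <<= meet x y.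
Proof.
have [[_ mA _ _ _] _ _] := HB.
by rewrite /leq_alg => zx zy; rewrite mA zx zy.
Qed.

Lemma join_lel x y : x <<= join x y.
Proof. by have [[_ _ _ _ [mj _]] _ _] := HB; apply: mj. Qed.

Lemma join_ler x y : y <<= join x y.
Proof. by have [[_ _ jC _ _] _ _] := HB; rewrite jC; apply: join_lel. Qed.

Lemma join_leq x y z : x <<= z -> y <<= z -> join x y <<= z.
Proof.
have [[mC _ jC jA [mj jm]] _ _] := HB.
have leE (u w : B) : u <<= w -> join u w = w.
  by rewrite /leq_alg => <-; rewrite jC mC jm.
by move=> /leE xz /leE yz; rewrite -xz -yz jA; apply: join_lel.
Qed.

Lemma leq_top x : x <<= top B. Proof. by have [_ + _] := HB; apply. Qed.

Lemma leq_imp x y z : x <<= imp y z <-> meet x y <<= z.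
Proof. by have [_ _ adj] := HB; split => /adj. Qed.

Lemma imp_mp x y : meet (imp x y) x <<= y.
Proof. by apply/leq_imp; apply: leq_refl_alg. Qed.

Lemma imp_top x y : x <<= y -> imp x y = top B.
Proof.
move=> xy; apply: leq_anti_alg; first exact: leq_top.
by apply/leq_imp; apply: leq_trans_alg xy; apply: meet_ler.
Qed.

Definition filter (G : B -> Prop) : Prop :=
  [/\ G (top B), forall x y, x <<= y -> G x -> G y &
      forall x y, G x -> G y -> G (meet x y)].

(** The improper filter is allowed: it is the dual counterpart of the absence of
    a bottom element, and without it traces of proper primes, which may be
    improper, would not be prime. *)
Definition prime_filter (P : B -> Prop) : Prop :=
  filter P /\ forall x y, P (join x y) -> P x \/ P y.

Lemma filter_meet G x y : filter G -> G (meet x y) <-> G x /\ G y.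
Proof.
move=> [_ up mt]; split=> [|[]]; last exact: mt.
by split; [apply: up (meet_lel x y) _|apply: up (meet_ler x y) _].
Qed.

Lemma filter_mp G x y : filter G -> G (imp x y) -> G x -> G y.
Proof. by move=> [_ up mt] gi gx; apply: up (imp_mp x y) _; apply: mt. Qed.

Lemma prime_join P x y : prime_filter P -> P (join x y) <-> P x \/ P y.
Proof.
move=> [[_ up _] pr]; split=> [|[]]; first exact: pr.
  exact/up/join_lel.
exact/up/join_ler.
Qed.

(** This is the filter generated by [G] and [D], written by residuation so that
    membership is again a statement about [G]. *)
Lemma filter_adjoin (G D : B -> Prop) : filter G ->
  D (top B) -> (forall x y, D x -> D y -> D (meet x y)) ->
  filter (fun y => exists2 d, D d & G (imp d y)).
Proof.
move=> [gt up mt] dt dm; split.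
- by exists (top B) => //; rewrite imp_top//; apply: leq_refl_alg.
- move=> x y xy [d Dd Gd]; exists d => //; apply: up Gd; apply/leq_imp.
  exact: leq_trans_alg (imp_mp d x) xy.
- move=> x y [d Dd Gd] [e De Ge]; exists (meet d e); first exact: dm.
  apply: up (mt _ _ Gd Ge); apply/leq_imp; apply: leq_meet.
    apply: leq_trans_alg (imp_mp d x); apply: leq_meet.
      exact: leq_trans_alg (meet_lel _ _) (meet_lel _ _).
    exact: leq_trans_alg (meet_ler _ _) (meet_lel _ _).
  apply: leq_trans_alg (imp_mp e y); apply: leq_meet.
    exact: leq_trans_alg (meet_lel _ _) (meet_ler _ _).
  exact: leq_trans_alg (meet_ler _ _) (meet_ler _ _).
Qed.

Lemma filter_imp (G : B -> Prop) x : filter G -> filter (fun y => G (imp x y)).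
Proof.
move=> gF; have [gt up mt] := gF; split.
- by rewrite imp_top//; apply: leq_top.
- move=> y z yz; apply: up; apply/leq_imp; exact: leq_trans_alg (imp_mp x y) yz.
- move=> y z gy gz; apply: up (mt _ _ gy gz); apply/leq_imp; apply: leq_meet.
    apply: leq_trans_alg (imp_mp x y); apply: leq_meet; last exact: meet_ler.
    exact: leq_trans_alg (meet_lel _ _) (meet_lel _ _).
  apply: leq_trans_alg (imp_mp x z); apply: leq_meet; last exact: meet_ler.
  exact: leq_trans_alg (meet_lel _ _) (meet_ler _ _).
Qed.

Lemma filter_principal b : filter (leq_alg b).
Proof.
split; [exact: leq_top|move=> x y xy bx; exact: leq_trans_alg bx xy|].
by move=> x y; apply: leq_meet.
Qed.

(** A filter that is maximal among those above [G] and disjoint from [J] is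
    prime: if it omits [x] and [y], then adjoining either one reaches [J], at
    [i] and [j] say, and a filter containing [join x y] would then contain
    [join i j]. *)
Lemma prime_filter_exists (G J : B -> Prop) :
  filter G -> (forall x y, J x -> J y -> J (join x y)) ->
  (forall x, G x -> ~ J x) ->
  exists P, [/\ prime_filter P, forall x, G x -> P x & forall x, P x -> ~ J x].
Proof.
move=> gF Jj GJ.
pose good (P : set B) :=
  [/\ filter P, forall x, G x -> P x & forall x, P x -> ~ J x].
(* The empty set is let in because it is the union of the empty chain. *)
have [F FP Ftot|M [Mgood Mmax]] :=
    @Zorn_bigcup B (fun P => (exists x, P x) -> good P).
  move=> [x0 [P0 FP0 P0x0]].
  have Fgood P x : F P -> P x -> good P by move=> /FP + Px; apply; exists x.
  split; first split.
  - by exists P0 => //; have [[+ _ _] _ _] := Fgood _ _ FP0 P0x0.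
  - move=> x y xy [P FPP Px]; exists P => //.
    by have [[_ up _] _ _] := Fgood _ _ FPP Px; apply: up Px.
  - move=> x y [P FPP Px] [Q FQ Qy].
    have [PQ|QP] := Ftot P Q FPP FQ.
      exists Q => //; have [[_ _ mt] _ _] := Fgood _ _ FQ Qy.
      by apply: mt => //; apply: PQ.
    exists P => //; have [[_ _ mt] _ _] := Fgood _ _ FPP Px.
    by apply: mt => //; apply: QP.
  - move=> x Gx; exists P0 => //.
    by have [_ + _] := Fgood _ _ FP0 P0x0; apply.
  - by move=> x [P FPP Px]; have [_ _] := Fgood _ _ FPP Px; apply.
have [gt _ _] := gF.
have [MF GM MJ] : good M.
  apply: Mgood; apply: contrapT => M0; apply: (Mmax G) => //.
  split=> [x Mx|GM]; first by case: M0; exists x.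
  by apply: M0; exists (top B); apply: GM.
exists M; split=> //; split=> // x y Mxy.
(* Adjoining an omitted element to M produces a filter that meets J. *)
have hit z : ~ M z -> exists2 j, M (imp z j) & J j.
  move=> nMz; apply: contrapT => noj.
  have [mt up _] := MF.
  apply: (Mmax (fun y => M (imp z y))); first split.
  - by move=> t Mt; apply: up Mt; apply/leq_imp; exact: meet_lel.
  - move=> /(_ z) Mz; apply/nMz/Mz.
    by rewrite imp_top//; exact: leq_refl_alg.
  - move=> _; split; first exact: filter_imp.
      by move=> t Gt; apply: up (GM t Gt); apply/leq_imp; exact: meet_lel.
    by move=> t Mt Jt; apply: noj; exists t.
apply: contrapT => /not_orP[/hit[i Mi Ji] /hit[j Mj Jj']].
have [_ up mt] := MF.
apply: (MJ (join i j)); last exact: Jj.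
apply: filter_mp Mxy => //; apply: up (mt _ _ Mi Mj).
apply/leq_imp; have [[mC _ _ _ _] _ _] := HB; rewrite mC; apply/leq_imp.
apply: join_leq; apply/leq_imp.
  apply: leq_trans_alg (join_lel _ _); apply: leq_trans_alg (imp_mp x i).
  apply: leq_meet; last exact: meet_lel.
  exact: leq_trans_alg (meet_ler _ _) (meet_lel _ _).
apply: leq_trans_alg (join_ler _ _); apply: leq_trans_alg (imp_mp y j).
apply: leq_meet; last exact: meet_lel.
exact: leq_trans_alg (meet_ler _ _) (meet_ler _ _).
Qed.

(** The Kripke reading of implication. For the converse direction, a prime that
    refutes [imp x y] is found above the filter generated by [P] and [x]. *)
Lemma prime_imp P x y : prime_filter P ->
  P (imp x y) <-> forall Q, prime_filter Q -> (forall z, P z -> Q z) ->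
                  Q x -> Q y.
Proof.
move=> [PF _]; split=> [Pi Q [QF _] PQ|H].
  by apply: filter_mp => //; apply: PQ.
apply: contrapT => nP.
have [|||Q [Qp PQ Qy]] := @prime_filter_exists (fun z => P (imp x z)) (eq y).
- exact: filter_imp.
- move=> _ _ <- <-; apply: leq_anti_alg; first exact: join_lel.
  by apply: join_leq; exact: leq_refl_alg.
- by move=> z Pz yz; apply: nP; rewrite yz.
apply: (Qy y) => //; apply: (H Q) => //.
  move=> z Pz; apply: PQ; have [_ up _] := PF; apply: up Pz.
  by apply/leq_imp; exact: meet_lel.
by apply: PQ; have [Pt _ _] := PF; rewrite imp_top//; exact: leq_refl_alg.
Qed.

(** * Congruences and homomorphisms from prime filters *)

Definition prime_upset (W : (B -> Prop) -> Prop) : Prop :=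
  (forall Q, W Q -> prime_filter Q) /\
  forall Q R, W Q -> prime_filter R -> (forall x, Q x -> R x) -> W R.

Definition prime_equiv (W : (B -> Prop) -> Prop) (x y : B) : Prop :=
  forall Q, W Q -> Q x <-> Q y.

(** Whether [Q] contains a meet or a join depends only on [Q], and whether it
    contains an implication depends only on the primes above [Q]; so the
    implication is respected precisely because [W] is closed upwards. *)
Lemma prime_equiv_congruence W : prime_upset W -> congruence (prime_equiv W).
Proof.
move=> [Wp Wup]; split=> [x Q|x y xy Q WQ|x y z xy yz Q WQ|].
- by [].
- by rewrite (xy Q WQ).
- by rewrite (xy Q WQ) (yz Q WQ).
case=> /= t u tu; last by rewrite (tuple0 t) (tuple0 u).
all: rewrite (tuple2E t) (tuple2E u) => Q WQ; have Qp := Wp Q WQ.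
- rewrite -/(imp _ _) -/(imp _ _) !(prime_imp _ _ Qp).
  split=> H R Rp QR; have WR := Wup _ _ WQ Rp QR.
    by rewrite -(tu _ R WR) -(tu _ R WR); apply: H.
  by rewrite (tu _ R WR) (tu _ R WR); apply: H.
- rewrite -/(meet _ _) -/(meet _ _).
  by rewrite !(filter_meet _ _ (proj1 Qp)) !(tu _ Q WQ).
- rewrite -/(join _ _) -/(join _ _).
  by rewrite !(prime_join _ _ Qp) !(tu _ Q WQ).
Qed.

(** A map [s] is the inverse image along a map [tau] of prime filters. The two
    hypotheses [tau_mono] and [tau_onto] say that [tau] sends the primes above
    [Q] onto the primes above [tau Q], which by [prime_imp] is what preserving
    the implication amounts to. *)
Lemma inverse_image_homomorphism W (tau : (B -> Prop) -> B -> Prop) s :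
  prime_upset W ->
  (forall Q, W Q -> prime_filter (tau Q)) ->
  (forall Q R, W Q -> W R -> (forall x, Q x -> R x) ->
     forall x, tau Q x -> tau R x) ->
  (forall Q R, W Q -> prime_filter R -> (forall x, tau Q x -> R x) ->
     exists2 Q', W Q' /\ (forall x, Q x -> Q' x) & tau Q' = R) ->
  (forall Q x, W Q -> Q (s x) <-> tau Q x) ->
  homomorphism_mod (prime_equiv W) s.
Proof.
move=> [Wp Wup] tau_prime tau_mono tau_onto sE.
case=> /= t Q WQ; have tQp := tau_prime Q WQ; have Qp := Wp Q WQ.
4: rewrite sE// (tuple0 t) (tuple0 (map_tuple _ _)) -/(top B).
4: by split=> _; [have [[]] := Qp|have [[]] := tQp].
all: rewrite sE// (tuple2E (map_tuple s t)) !tnth_map.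
all: rewrite [in X in X <-> _](tuple2E t).
- rewrite -/(imp _ _) -/(imp _ _) !prime_imp//; split=> H R Rp QR.
    have WR := Wup _ _ WQ Rp QR; rewrite !sE//.
    by apply: H; [exact: tau_prime|exact: tau_mono].
  have [Q' [WQ' QQ'] <-] := tau_onto Q R WQ Rp QR.
  by rewrite -!sE//; apply: H => //; exact: Wp.
- rewrite -/(meet _ _) -/(meet _ _).
  by rewrite (filter_meet _ _ (proj1 tQp)) (filter_meet _ _ (proj1 Qp)) !sE.
- by rewrite -/(join _ _) -/(join _ _) !prime_join// !sE.
Qed.

(** * Bounded depth *)

(** Given a descending chain of prime filters such that [v i] lies in the [i]-th
    one but not in the next, the value at stage [i] also lies outside the next.
    Requiring this value to be always the top therefore bounds the length of
    such chains. *)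
Fixpoint depth_value (v : nat -> B) (n : nat) : B :=
  if n is m.+1 then join (v n) (imp (v n) (depth_value v m)) else v 0.

Definition depth_at_most n := forall v, depth_value v n = top B.

Lemma eq_depth_value v w n :
  (forall i, i <= n -> v i = w i) -> depth_value v n = depth_value w n.
Proof.
elim: n => [|n IH] vw /=; first exact: vw.
by rewrite vw// IH// => i /leqW; apply: vw.
Qed.

Lemma depth_value_le v n : depth_value v n <<= depth_value v n.+1.
Proof.
apply: leq_trans_alg (join_ler _ _); apply/leq_imp; exact: meet_lel.
Qed.

(** If [x \/ (x -> d) <= d] then [x <= d], so [x -> d] is the top; as this
    implication lies below [d] too, [d] is the top. *)
Lemma depth_value_stationary v n :
  depth_value v n.+1 <<= depth_value v n -> depth_value v n = top B.
Proof.
move=> le; have vle : v n.+1 <<= depth_value v n.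
  by apply: leq_trans_alg le; exact: join_lel.
apply: leq_anti_alg; first exact: leq_top.
by apply: leq_trans_alg le; rewrite /= -(imp_top vle); exact: join_ler.
Qed.

Lemma depth_value_mono v m n :
  m <= n -> depth_value v m <<= depth_value v n.
Proof.
elim: n => [|n IH]; first by rewrite leqn0 => /eqP ->; exact: leq_refl_alg.
rewrite leq_eqVlt => /orP[/eqP ->|mn]; first exact: leq_refl_alg.
exact: leq_trans_alg (IH mn) (depth_value_le v n).
Qed.

(** The values [depth_value v i] increase strictly until they reach the top, and
    an algebra of [n] elements leaves no room for [n.+1] distinct values. *)
Lemma finite_depth : finite_set [set: B] -> exists n, depth_at_most n.
Proof.
move=> /finite_setP[n /card_set_bijP[f [fto finj _]]].
have fI x y : f x = f y -> x = y by apply: finj; rewrite inE.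
have flt x : f x < n by apply: fto.
exists n => v; apply: contrapT => nt.
(* If the top is not reached by stage n, all stages up to n are distinct. *)
have inj : {in iota 0 n.+1 &, injective (f \o depth_value v)}.
  have key i j : i < j <= n -> depth_value v i <> depth_value v j.
    move=> /andP[ij jn] e; apply: nt.
    apply: leq_anti_alg; first exact: leq_top.
    have <- : depth_value v i = top B.
      by apply: depth_value_stationary; rewrite e; apply: depth_value_mono.
    by apply: depth_value_mono; rewrite (leq_trans _ jn)// ltnW.
  move=> i j; rewrite !mem_iota !add0n !ltnS /= => ile jle /fI e.
  case: (ltngtP i j) => // lt; first by case: (@key i j); rewrite ?lt.
  by case: (@key j i); rewrite ?lt.
have u : uniq (map (f \o depth_value v) (iota 0 n.+1)).
  by rewrite map_inj_in_uniq// iota_uniq.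
have := @uniq_leq_size _ _ (iota 0 n) u.
rewrite size_map !size_iota ltnn => /(_ _)/notF; apply.
by move=> _ /mapP[i _ ->]; rewrite mem_iota add0n /= flt.
Qed.

Definition strictly_below (P Q : B -> Prop) :=
  (forall x, P x -> Q x) /\ exists2 x, Q x & ~ P x.

(** Without maximal member, every member [P] of [U] has a strictly larger one,
    and climbing [k] times yields elements that refute [depth_value v k] at [P]:
    if [Q] is above [P], omits the value at stage [k], and contains some [x]
    outside [P], then [P] contains neither [x] nor the implication from [x] to
    that value. *)
Lemma prime_maximal n (U : (B -> Prop) -> Prop) :
  depth_at_most n -> (forall P, U P -> prime_filter P) -> (exists P, U P) ->
  exists2 P, U P & forall Q, U Q -> ~ strictly_below P Q.
Proof.
move=> dn Upr [P0 UP0]; apply: contrapT => noM.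
have step P : U P -> exists2 Q, U Q & strictly_below P Q.
  move=> UP; apply: contrapT => noQ; apply: noM; exists P => // Q UQ PQ.
  by apply: noQ; exists Q.
have esc k P : U P -> exists v, ~ P (depth_value v k).
  elim: k P => [|k IH] P UP; have [Q UQ [PQ [x Qx nPx]]] := step P UP.
    by exists (fun=> x).
  have [v nv] := IH Q UQ.
  exists (fun i => if i == k.+1 then x else v i).
  rewrite /= eqxx (@eq_depth_value _ v); last first.
    by move=> i ik; rewrite ltn_eqF// ltnS.
  move=> /(prime_join _ _ (Upr P UP))[//|/PQ Qi]; apply: nv.
  by apply: filter_mp Qi Qx; have [] := Upr Q UQ.
have [v] := esc n P0 UP0; rewrite dn; apply.
by have [[]] := Upr P0 UP0.
Qed.

End Order.

(** * Prime filters with the same trace *)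

Section Separation.
Variables (A B : algebra brouwerian_sig) (h : A -> B).
Hypotheses (HB : brouwerian B) (hh : homomorphism h).
Implicit Types P Q : B -> Prop.
Local Notation "x <<= y" := (leq_alg x y) (at level 70).

Lemma hom_imp x y : h (imp x y) = imp (h x) (h y).
Proof. by rewrite /imp hh; congr (interp _); apply: val_inj. Qed.
Lemma hom_meet x y : h (meet x y) = meet (h x) (h y).
Proof. by rewrite /meet hh; congr (interp _); apply: val_inj. Qed.
Lemma hom_join x y : h (join x y) = join (h x) (h y).
Proof. by rewrite /join hh; congr (interp _); apply: val_inj. Qed.
Lemma hom_top : h (top A) = top B.
Proof. by rewrite /top hh; congr (interp _); apply: val_inj. Qed.

Definition same_trace P Q := forall a, P (h a) <-> Q (h a).

(** The filter generated by [G] and the image elements of [Q] avoids the image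
    elements outside [Q]: from [meet g (h a) <= h c] with [g] in [G] follows
    that [G] contains [h (imp a c)], hence so does [Q]. Any prime that separates
    the two sets has the trace of [Q]. *)
Lemma prime_lift (G Q : B -> Prop) : filter G -> prime_filter Q ->
  (forall a, G (h a) -> Q (h a)) ->
  exists P, [/\ prime_filter P, forall x, G x -> P x & same_trace P Q].
Proof.
move=> GF Qp GQ; have [QF _] := Qp.
have [Qt Qup Qm] := QF.
pose D y := exists2 a, h a = y & Q y.
pose J y := exists2 a, h a = y & ~ Q y.
have DF : filter (fun y => exists2 d, D d & G (imp d y)).
  apply: filter_adjoin => //; first by exists (top A); rewrite ?hom_top.
  move=> _ _ [a <- Qa] [b <- Qb]; exists (meet a b); first exact: hom_meet.
  exact: Qm.
have [||P [Pp GP PJ]] := @prime_filter_exists B HB _ J DF.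
- move=> _ _ [a <- Qa] [b <- Qb]; exists (join a b); first exact: hom_join.
  by move=> /prime_join -/(_ HB Qp)[].
- move=> x [d [a ad Qa] Gab] [b bx nQb]; subst x d; apply: nQb.
  by apply: filter_mp Qa => //; rewrite -hom_imp; apply: GQ; rewrite hom_imp.
exists P; split=> //.
  move=> x Gx; apply: GP; exists (top B); last first.
    by have [_ up _] := GF; apply: up Gx; apply/leq_imp => //; exact: meet_lel.
  by exists (top A); rewrite ?hom_top.
move=> a; split=> [Pa|Qa].
  by apply: contrapT => nQa; apply: (PJ (h a)) => //; exists a.
apply: GP; exists (h a); first by exists a.
by rewrite imp_top//; [have [] := GF|exact: leq_refl_alg].
Qed.

(** First [Q] is chosen to omit [b] but to contain every image element above
    [b]; then the principal filter of [b] can be enlarged to a prime with the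
    trace of [Q]. *)
Lemma same_trace_primes b : (forall a, h a <> b) ->
  exists P Q, [/\ prime_filter P, prime_filter Q, P <> Q & same_trace P Q].
Proof.
move=> nb.
have GF : filter (fun y => exists2 a, b <<= h a & h a <<= y).
  split.
  - by exists (top A); rewrite hom_top; exact: leq_top.
  - by move=> x y xy [a ba ax]; exists a => //; exact: leq_trans_alg ax xy.
  - move=> x y [a ba ax] [c bc cy]; exists (meet a c); rewrite hom_meet.
      exact: leq_meet.
    apply: leq_meet => //.
      by apply: leq_trans_alg ax => //; exact: meet_lel.
    by apply: leq_trans_alg cy => //; exact: meet_ler.
have [||Q [Qp GQ Qb]] := @prime_filter_exists B HB _ (eq b) GF.
- move=> _ _ <- <-; apply: leq_anti_alg => //; first exact: join_lel.
  by apply: join_leq => //; exact: leq_refl_alg.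
- move=> x [a ba ax] bx; apply: (nb a); apply: leq_anti_alg => //.
  by rewrite bx.
have [|P [Pp bP PQ]] := prime_lift (filter_principal HB b) Qp.
  by move=> a ba; apply: GQ; exists a => //; exact: leq_refl_alg.
exists P, Q; split=> // e; apply: (Qb b) => //; rewrite -e.
by apply: bP; exact: leq_refl_alg.
Qed.

(** [P] is maximal among the primes that share their trace with another prime,
    and [P'] maximal among the others with the trace of [P]. A prime above one
    of them is compared with a prime of the same trace above the other, which
    exists by [prime_lift]; the choices of [P] and [P'] force the two to be
    equal, up to the exceptions listed. *)
Lemma separating_primes n b : depth_at_most B n -> (forall a, h a <> b) ->
  exists P P' : B -> Prop,
    [/\ prime_filter P /\ prime_filter P', same_trace P P',
        exists2 v, P v & ~ P' v,
        forall Q, prime_filter Q -> (forall x, P x -> Q x) ->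
          Q = P \/ strictly_below P' Q &
        forall Q, prime_filter Q -> (forall x, P' x -> Q x) ->
          Q = P' \/ forall x, P x -> Q x].
Proof.
move=> dn nb.
have above P Q : (forall x, P x -> Q x) -> Q = P \/ strictly_below P Q.
  move=> PQ; have [QP|nQP] := pselect (forall x, Q x -> P x).
    by left; apply/funext => x; apply/propext; split; [apply: QP|apply: PQ].
  right; split=> //; apply: contrapT => nx; apply: nQP => x Qx.
  by apply: contrapT => nPx; apply: nx; exists x.
have [||P [Pp [P0 [P0p P0P tP0]]] Pmax] := @prime_maximal B HB n
  (fun P => prime_filter P /\
     exists Q, [/\ prime_filter Q, Q <> P & same_trace P Q]) dn.
- by move=> P [].
- have [P [Q [Pp Qp PQ tPQ]]] := same_trace_primes nb.
  by exists P; split=> //; exists Q; split=> // /esym.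
have [||P' [P'p P'P tP'] P'max] := @prime_maximal B HB n
  (fun P' => [/\ prime_filter P', P' <> P & same_trace P P']) dn.
- by move=> Q [].
- by exists P0.
(* Otherwise Q would be a larger choice for P. *)
have single Q R : prime_filter Q -> strictly_below P Q -> prime_filter R ->
    same_trace Q R -> R = Q.
  move=> Qp PQ Rp QR; apply: contrapT => RQ; apply: (Pmax Q) => //.
  by split=> //; exists R.
exists P, P'; split=> //.
- apply: contrapT => nv.
  have [|/P'P//|PP'] := above P P'.
    by move=> x Px; apply: contrapT => nx; apply: nv; exists x.
  apply: (Pmax P') => //; split=> //; exists P; split=> //.
    by move=> e; apply: P'P.
  by move=> a; split=> /tP'.
- move=> Q Qp PQ; have [->|sPQ] := above P Q PQ; [by left|right].
  have [a /tP'|R [Rp P'R RQ]] := @prime_lift P' Q (proj1 P'p) Qp.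
    exact: PQ.
  have e : R = Q by apply: single => // a; split=> /RQ.
  have [|QP'|//] := above P' Q; first by rewrite -e.
  case: P'P; rewrite -QP'; apply/esym/single => //.
  by rewrite QP' => a; split=> /tP'.
- move=> Q Qp P'Q; have [->|sP'Q] := above P' Q P'Q; [by left|right].
  have [a /tP'|R [Rp PR RQ]] := @prime_lift P Q (proj1 Pp) Qp.
    exact: P'Q.
  have [RP|sPR] := above P R PR; last first.
    by rewrite (single R Q).
  have [->//|QP] := pselect (Q = P).
  by case: (P'max Q) => //; split=> //; rewrite -RP.
Qed.

(** The congruence is that of the quotient by [P'], and [s] is dual to the map
    that collapses [P'] to [P]. An element of [P] goes to the top. Any other
    element must be removed from [P'] while its membership in the larger primes
    is kept, and the meet with [v] does this. *)
Lemma separating_congruence n b : depth_at_most B n -> (forall a, h a <> b) ->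
  exists (th : B -> B -> Prop) (s : B -> B),
    [/\ congruence th, homomorphism_mod th s, forall a, th (s (h a)) (h a) &
        exists v, ~ th (s v) v].
Proof.
move=> dn nb.
have [P [P' [[Pp P'p] tPP' [v Pv nP'v] abP abP']]] := separating_primes dn nb.
pose W Q := prime_filter Q /\ forall x, P' x -> Q x.
(* Modulo prime_equiv W, v is the largest element below the top: it lies in
   every prime above P' except P' itself. *)
pose s x := if `[< P x >] then top B else meet x v.
pose tau Q := if `[< Q = P' >] then P else Q.
have tauP' : tau P' = P by rewrite /tau; case: asboolP.
have tauN Q : Q <> P' -> tau Q = Q by rewrite /tau; case: asboolP.
have sE Q x : W Q -> Q (s x) <-> tau Q x.
  move=> [Qp P'Q]; have [QF _] := Qp; have [Qt _ _] := QF.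
  have [QP'|QP'] := pselect (Q = P').
    rewrite QP' tauP' /s; case: asboolP => [Px|nPx].
      by split=> // _; rewrite -QP'.
    by split=> // /filter_meet -/(_ HB (proj1 P'p))[].
  rewrite tauN//; have [//|PQ] := abP' Q Qp P'Q.
  rewrite /s; case: asboolP => [Px|nPx]; first by split=> // _; apply: PQ.
  by rewrite filter_meet//; split=> [[]//|Qx]; split=> //; apply: PQ.
have upW : prime_upset W.
  by split=> [Q []//|Q R [_ P'Q] Rp QR]; split=> // x /P'Q /QR.
exists (prime_equiv W), s; split; first exact: prime_equiv_congruence.
- apply: (inverse_image_homomorphism HB (tau := tau)) => //.
  + by move=> Q [Qp _]; rewrite /tau; case: ifP.
  + move=> Q R [Qp P'Q] [Rp P'R] QR; have [RP'|RP'] := pselect (R = P').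
      have -> // : Q = R; apply/funext => x; apply/propext.
      by split; [apply: QR|rewrite RP'; apply: P'Q].
    rewrite (tauN R)// /tau; case: asboolP => // QP'.
    by have [|] := abP' R Rp P'R.
  + move=> Q R [Qp P'Q] Rp; have [->|QP'] := pselect (Q = P').
      rewrite tauP' => PR.
      have [->|[P'R [x Rx nP'x]]] := abP R Rp PR; first by exists P'.
      by exists R => //; rewrite tauN// => e; apply: nP'x; rewrite -e.
    rewrite tauN// => QR; exists R; first by do 2![split=> //] => x /P'Q /QR.
    rewrite tauN// => e; apply: QP'; apply/funext => x; apply/propext.
    by split; [rewrite -e; apply: QR|apply: P'Q].
- move=> a Q WQ; rewrite sE//; have [QP'|QP'] := pselect (Q = P').
    by rewrite QP' tauP'; exact: tPP'.
  by rewrite tauN.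
- exists v => /(_ P' (conj P'p (fun x Px => Px))).
  by rewrite sE; [rewrite tauP' => -[/(_ Pv)]|split].
Qed.

End Separation.

(** * Transfer of equations *)

Definition depth_term_op (o : op brouwerian_sig) (s t : term brouwerian_sig) :
  term brouwerian_sig :=
  App (fun i : 'I_(arity o) => if val i == 0 then s else t).

Fixpoint depth_term (n : nat) : term brouwerian_sig :=
  if n is m.+1 then
    depth_term_op OpJoin (Var _ n)
      (depth_term_op OpImp (Var _ n) (depth_term m))
  else Var _ 0.

Definition depth_equation n : term brouwerian_sig * term brouwerian_sig :=
  (depth_term n, App (o := OpTop : op brouwerian_sig) (fun=> Var _ 0)).

Lemma eval_depth_term (B : algebra brouwerian_sig) (v : nat -> B) n :
  eval v (depth_term n) = depth_value v n.
Proof.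
have E (x y : B) (f : 'I_2 -> B) : f ord0 = x -> f (lift ord0 ord0) = y ->
    [tuple f i | i < 2] = [tuple x; y].
  move=> fx fy; apply: eq_from_tnth => i; rewrite tnth_mktuple.
  case: i => [[|[|//]]] i; rewrite /tnth /= -?fx -?fy;
    by congr f; apply: val_inj.
elim: n => [//|n IH] /=.
rewrite /join; congr (interp _); apply: (E) => //=.
by rewrite /imp; congr (interp _); apply: (E) => //=.
Qed.

Lemma satisfies_depth_equation (B : algebra brouwerian_sig) n :
  satisfies B (depth_equation n) <-> depth_at_most B n.
Proof.
have topE (v : nat -> B) : eval v (depth_equation n).2 = top B.
  by rewrite /= /top; congr (interp _); rewrite [LHS]tuple0.
by split=> H v; have := H v; rewrite topE eval_depth_term.
Qed.

(** The models of a single equation form a variety. *)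
Lemma variety_generated_satisfies (S : signature) (F : algebra S) K e :
  variety_generated_by F K -> satisfies F e -> forall A, K A -> satisfies A e.
Proof.
move=> [_ _ gen] Fe; apply: gen => //.
by exists (eq e) => A; split=> [Ae _ <- //|]; apply.
Qed.

Fixpoint heyting_term (t : term brouwerian_sig) : term heyting_sig :=
  match t with
  | Var n => Var _ n
  | App o ts =>
      @App heyting_sig (OpBrouwerian o) (fun i => heyting_term (ts i))
  end.

Lemma eval_heyting_term (A : algebra heyting_sig) (v : nat -> A) t :
  eval v (heyting_term t) = eval (v : nat -> brouwerian_reduct A) t.
Proof.
elim: t => [//|o ts IH] /=; congr (interp _); apply: eq_from_tnth => i.
by rewrite !tnth_mktuple IH.
Qed.

Theorem corollary5p5 :
  (forall K : algebra heyting_sig -> Prop,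
     finitely_generated_variety K ->
     (forall A : algebra heyting_sig, K A -> heyting A) ->
     forall (A B : algebra heyting_sig) (h : A -> B),
       epimorphism K h -> forall b : B, exists a : A, h a = b)
  /\
  (forall K : algebra brouwerian_sig -> Prop,
     finitely_generated_variety K ->
     (forall A : algebra brouwerian_sig, K A -> brouwerian A) ->
     forall (A B : algebra brouwerian_sig) (h : A -> B),
       epimorphism K h -> forall b : B, exists a : A, h a = b).
Proof.
split=> K [F Ffin KF] KH A B h hepi b; have [Kvar FK _] := KF;
  have [KA KB hh _] := hepi; apply: contrapT => nb.
- have [n Fn] := finite_depth (proj1 (KH F FK)) Ffin.
  have Bn : depth_at_most (brouwerian_reduct B) n.
    apply/satisfies_depth_equation => v; rewrite -!eval_heyting_term.
    apply: (variety_generated_satisfies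
      (e := (heyting_term (depth_equation n).1,
             heyting_term (depth_equation n).2)) KF) => // w.
    rewrite !eval_heyting_term.
    exact: (proj2 (satisfies_depth_equation (brouwerian_reduct F) n) Fn).
  have rh : @homomorphism _ (brouwerian_reduct A) (brouwerian_reduct B) h.
    by move=> o t; apply: (hh (OpBrouwerian o)).
  have [|th [s [thC sh sA [v nv]]]] :=
    separating_congruence (proj1 (KH B KB)) rh (b := b) Bn.
    by move=> a e; apply: nb; exists a.
  apply: nv; refine (@epimorphism_congruence _ K A B h th s Kvar hepi _ _ sA v).
  + have [rf sy tr compat] := thC; split=> // -[o|] t u tu; first exact: compat.
    by rewrite (tuple0 t) (tuple0 u).
  + case=> [o|] t; first exact: (sh o).
    have -> : interp t = h (bot A).
      by rewrite /bot hh (tuple0 (map_tuple h _)) [X in interp X]tuple0.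
    have -> : interp (map_tuple s t) = h (bot A).
      by rewrite /bot hh (tuple0 (map_tuple h _)) [X in interp X]tuple0.
    exact: sA.
- have [n Fn] := finite_depth (KH F FK) Ffin.
  have Bn : depth_at_most B n.
    apply/satisfies_depth_equation.
    apply: (variety_generated_satisfies KF) KB.
    exact/satisfies_depth_equation.
  have [|th [s [thC sh sA [v nv]]]] :=
    separating_congruence (KH B KB) hh (b := b) Bn.
    by move=> a e; apply: nb; exists a.
  by apply: nv; exact: (epimorphism_congruence Kvar hepi thC sh sA).
Qed.
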